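(* Fix $(\alpha,\beta,\theta)\in(0,1)^3$ and suppose $\alpha>\eta^{sig}_\theta(\beta)$. Consider the signal recovery problem in the ARW model with parameters $(\alpha,\beta,\theta)$. For any estimate $\hat S=\hat S(X)\subset\{1,\dots,p\}$ of the support $S(\mu)$, $\mathrm{Hamm}_p(\hat S,\alpha,\beta,\theta)\gtrsim1$ as $p\to\infty$, i.e. $\liminf_{p\to\infty}\mathrm{Hamm}_p(\hat S,\alpha,\beta,\theta)\ge1$.
   Context: ARW model. For each $p$ let $n=n_p=p^\theta$ (treated as an integer), $\epsilon_p=p^{-\beta}$, $\tau_p=p^{-\alpha}$. The labels $\ell_1,\dots,\ell_n$ are i.i.d. uniform on $\{-1,1\}$; the coordinates of $\mu\in\mathbb R^p$ are i.i.d., equal to $\tau_p$ with probability $\epsilon_p$ and to $0$ with probability $1-\epsilon_p$; $Z$ is an $n\times p$ matrix with i.i.d. $N(0,1)$ entries; $\ell,\mu,Z$ are independent. One observes $X=\ell\mu'+Z\in\mathbb R^{n\times p}$. The support is $S(\mu)=\{1\le j\le p:\mu(j)\ne0\}$. Signal recovery error. $\mathrm{Hamm}_p(\hat S,\alpha,\beta,\theta)=(p\epsilon_p)^{-1}E(|\hat S\,\Delta\,S(\mu)|)$, where $\Delta$ is the symmetric difference and the expectation is over $(\mu,\ell,Z)$. The curve: $\eta^{sig}_\theta(\beta)=\theta/2$ for $\beta\le1-\theta$ and $\eta^{sig}_\theta(\beta)=(1+\theta-\beta)/4$ for $\beta\ge1-\theta$. *)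

(* Defs.v *)
From HB Require Import structures.
From mathcomp Require Import all_boot all_order all_algebra.
From mathcomp Require Import all_classical all_reals all_analysis.

Set Implicit Arguments.
Unset Strict Implicit.
Unset Printing Implicit Defensive.

Import Order.TTheory GRing.Theory Num.Theory.
Import numFieldNormedType.Exports.

Local Open Scope classical_set_scope.
Local Open Scope ring_scope.

Definition mutually_independent (R : realType) (d : measure_display)
    (T : measurableType d) (P : probability T R) (I : finType)
    (X : I -> {RV P >-> R}) : Prop :=
  forall (J : {set I}) (B : I -> set R), (forall k, measurable (B k)) ->
    P (\bigcap_(k in [set` J]) (X k @^-1` B k)) =
    (\prod_(k in J) P (X k @^-1` B k))%E.

Section ARW.
Variable R : realType.
Implicit Types (alpha beta theta : R) (p : nat).

Definition eps beta p : R := p%:R `^ (- beta).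

Definition tau alpha p : R := p%:R `^ (- alpha).

(* n p is p ^ theta rounded to an integer; no particular rounding (floor,
   ceiling, nearest) is imposed, and n p = p ^ theta if the latter is an
   integer. *)
Definition sample_size theta (n : nat -> nat) : Prop :=
  forall p, `|(n p)%:R - p%:R `^ theta| < 1.

Definition eta_sig theta beta : R :=
  if beta <= 1 - theta then theta / 2 else (1 + theta - beta) / 4.

Section fixed_dimension.
Variables (d : measure_display) (T : measurableType d) (P : probability T R).
Variables (n p : nat).
Variables (mu : 'I_p -> {RV P >-> R}) (ell : 'I_n -> {RV P >-> R}).
Variable Z : 'I_n -> 'I_p -> {RV P >-> R}.

Definition arw_entry (k : 'I_p + 'I_n + 'I_n * 'I_p) : {RV P >-> R} :=
  match k with
  | inl (inl j) => mu j
  | inl (inr i) => ell i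
  | inr (i, j) => Z i j
  end.

Record ARW_model alpha beta : Prop := {
  ARW_mu_tau : forall j, P (mu j @^-1` [set tau alpha p]) = (eps beta p)%:E;
  ARW_mu_0 : forall j, P (mu j @^-1` [set 0]) = (1 - eps beta p)%:E;
  ARW_ell_1 : forall i, P (ell i @^-1` [set 1]) = (2^-1)%:E;
  ARW_ell_N1 : forall i, P (ell i @^-1` [set -1]) = (2^-1)%:E;
  ARW_Z : forall i j (A : set R), measurable A ->
    distribution P (Z i j) A = normal_prob 0 1 A;
  ARW_indep : mutually_independent arw_entry
}.

Definition observation (w : T) : 'M[R]_(n, p) :=
  (\col_i ell i w) *m (\row_j mu j w) + \matrix_(i, j) Z i j w.

Definition support_mu (w : T) : {set 'I_p} := [set j | mu j w != 0]%SET.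

(* The product sigma-algebra on n x p matrices, which is also the Borel one. *)
Definition mx_sigma_algebra : set (set 'M[R]_(n, p)) :=
  <<s [set A | exists i j (B : set R), measurable B /\
         A = (fun X : 'M[R]_(n, p) => X i j) @^-1` B] >>.

Definition measurable_estimate (Shat : 'M[R]_(n, p) -> {set 'I_p}) : Prop :=
  forall C : set {set 'I_p}, mx_sigma_algebra (Shat @^-1` C).

Definition symdiff (A B : {set 'I_p}) : {set 'I_p} :=
  ((A :\: B) :|: (B :\: A))%SET.

Definition Hamm beta (Shat : 'M[R]_(n, p) -> {set 'I_p}) : \bar R :=
  (((p%:R * eps beta p)^-1)%:E *
   'E_P[fun w => #|symdiff (Shat (observation w)) (support_mu w)|%:R])%E.

End fixed_dimension.
End ARW.

(* Main.v *)
(** For each coordinate [j] the oracle who knows all the other entries of [mu]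
    still has to test [mu_j = 0] against [mu_j = tau] with prior odds
    [r = eps / (1 - eps)].  Writing [f] and [f'] for the two densities of the data
    (the signs [ell] being averaged out), [r f' <= f + (r f')^2 / f] bounds the
    error of any test from below by [eps - r^2 * (second moment of f' / f)], so it
    suffices that this second moment, averaged over the other entries of [mu], stays
    bounded, because [eps] tends to 0.  The rows being independent, it is the n-th
    power of [cosh x + E tanh^2 * sinh x] with [x = tau^2] and
    [E tanh^2 <= 2 (1 - exp (- q / 2))], where [q] is the squared norm of the other
    entries.  Bounding [E tanh^2] by a constant gives [exp (O (n tau^2))], which is
    bounded when [alpha > theta / 2]; bounding it by [q] and averaging over the
    binomial size of the support gives [exp (O (n tau^4 (1 + p eps)))], which is
    bounded when [alpha > (1 + theta - beta) / 4] and [beta > 1 - theta]. *)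

Require Import Defs.
From HB Require Import structures.
From mathcomp Require Import all_boot all_order all_algebra.
From mathcomp Require Import all_classical all_reals all_analysis.
From mathcomp Require Import measurable_realfun ring lra.

Set Implicit Arguments.
Unset Strict Implicit.
Unset Printing Implicit Defensive.

Import Order.TTheory GRing.Theory Num.Theory.
Import numFieldNormedType.Exports.

Local Open Scope classical_set_scope.
Local Open Scope ring_scope.

(** * Measures with a density *)

Section weighted_measure.
Context d (T : measurableType d) (R : realType).
Local Open Scope ereal_scope.
Import HBNNSimple.

(** Packing the weighted set function as a measure makes pushforwards and uniqueness of measures
    available for it. *)
Lemma weighted_measure (mu : {measure set T -> \bar R}) (g : T -> R) :
  measurable_fun setT g -> (forall x, (0 <= g x)%R) ->
  exists m : {measure set T -> \bar R},
    forall A, m A = \int[mu]_(x in A) (g x)%:E.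
Proof.
move=> mg g0; pose m A := \int[mu]_(x in A) (g x)%:E.
have m0 : m set0 = 0 by rewrite /m integral_set0.
have mge0 A : 0 <= m A by apply: integral_ge0 => x _; rewrite lee_fin.
have madd : semi_sigma_additive m.
  move=> /= F mF tF mUF; rewrite /m ge0_integral_bigcup//; last 2 first.
  - exact/measurable_EFinP/measurable_funTS.
  - by move=> x _; rewrite lee_fin.
  by apply: is_cvg_ereal_nneg_natsum_cond => n _ _; exact: mge0.
pose M : {measure set T -> \bar R} :=
  HB.pack m (isMeasure.Build _ _ _ m m0 mge0 madd).
by exists M.
Qed.

(** Linearity settles simple functions, and monotone convergence along [nnsfun_approx] on both sides
    settles the rest. *)
Lemma integral_weighted (mu m : {measure set T -> \bar R})
    (g : T -> R) (f : T -> \bar R) :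
  measurable_fun setT g -> (forall x, (0 <= g x)%R) ->
  (forall A, measurable A -> m A = \int[mu]_(x in A) (g x)%:E) ->
  measurable_fun setT f -> (forall x, 0 <= f x) ->
  \int[m]_x f x = \int[mu]_x (f x * (g x)%:E).
Proof.
move=> mg g0 mE mf f0; pose f_ := nnsfun_approx measurableT mf.
have nnsf (h : {nnsfun T >-> R}) :
    \int[m]_x (h x)%:E = \int[mu]_x ((h x)%:E * (g x)%:E).
  under eq_integral do rewrite fimfunE -fsumEFin//.
  rewrite ge0_integral_fsum//; last 2 first.
  - by move=> r; exact/measurable_EFinP/measurable_funM.
  - by move=> r x _; rewrite nnfun_muleindic_ge0.
  transitivity (\sum_(r \in range h)
      \int[mu]_x ((r * \1_(h @^-1` [set r]) x)%:E * (g x)%:E)).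
    apply: eq_fsbigr => r; rewrite inE => -[y _ <-].
    rewrite integralZl_indic_nnsfun// integral_indic// setIT mE//.
    rewrite integral_mkcond.
    transitivity ((h y)%:E *
        \int[mu]_x (\1_(h @^-1` [set h y]) x * g x)%:E).
      congr *%E; apply: eq_integral => x _.
      by rewrite patchE indicE; case: ifP; rewrite ?mul1r ?mul0r.
    rewrite -ge0_integralZl//=.
    - by apply: eq_integral => x _; rewrite -!EFinM mulrA.
    - exact/measurable_EFinP/measurable_funM.
    - by move=> x _; rewrite lee_fin mulr_ge0.
    - by rewrite lee_fin.
  rewrite -ge0_integral_fsum//.
  - apply: eq_integral => x _; rewrite [in RHS]fimfunE -fsumEFin//.
    rewrite ge0_mule_fsuml// => r.
    exact: nnfun_muleindic_ge0.
  - move=> r; apply: emeasurable_funM; last exact/measurable_EFinP.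
    exact/measurable_EFinP/measurable_funM.
  - by move=> r x _; rewrite mule_ge0 ?nnfun_muleindic_ge0// lee_fin.
transitivity (limn (fun n => \int[m]_x (f_ n x)%:E)).
  rewrite -monotone_convergence//.
  - by apply: eq_integral => x _; apply/esym/cvg_lim => //;
      exact: cvg_nnsfun_approx.
  - by move=> n; exact/measurable_EFinP.
  - by move=> n x _; rewrite lee_fin.
  - by move=> x _ a b ab; rewrite lee_fin; exact/lefP/nd_nnsfun_approx.
under eq_fun do rewrite nnsf.
rewrite -monotone_convergence//.
- apply: eq_integral => x _; apply/cvg_lim => //.
  have fx : (f_ n x)%:E @[n --> \oo] --> f x by exact: cvg_nnsfun_approx.
  by apply: cvgeZr.
- by move=> n; apply: emeasurable_funM; exact/measurable_EFinP.
- by move=> n x _; rewrite -EFinM lee_fin mulr_ge0.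
- move=> x _ a b ab; rewrite -!EFinM lee_fin ler_wpM2r//.
  exact/lefP/nd_nnsfun_approx.
Qed.
End weighted_measure.

(** * Independent products and shifted Gaussians *)

(** The hypothesis on [A] says that under the measure of density [g] the image of [X] is [c] times
    its law under [P]; equal measures have equal integrals. *)
Lemma integral_mul_factor d (T : measurableType d) (R : realType)
    (P : probability T R) (X : {RV P >-> R}) (g : T -> R) (f : R -> R)
    (c : {nonneg R}) :
  measurable_fun setT g -> (forall w, 0 <= g w) ->
  (forall A, measurable A ->
    (\int[P]_w (g w * \1_A (X w))%:E = c%:num%:E * P (X @^-1` A))%E) ->
  measurable_fun setT f -> (forall x, 0 <= f x) ->
  (\int[P]_w (g w * f (X w))%:E = c%:num%:E * \int[P]_w (f (X w))%:E)%E.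
Proof.
move=> mg g0 gX mf f0.
have [m mE] := weighted_measure P mg g0.
have mEf : measurable_fun setT (EFin \o f) by exact/measurable_EFinP.
have fE0 x : (0 <= (EFin \o f) x)%E by rewrite /= lee_fin.
have mfX : measurable_fun setT (EFin \o (f \o X)).
  by apply/measurable_EFinP; exact: measurableT_comp.
transitivity (\int[m]_w (f (X w))%:E)%E.
  rewrite (integral_weighted (f := EFin \o (f \o X)) (mu := P) mg g0)//.
    by apply: eq_integral => w _; rewrite /= -EFinM mulrC.
  by move=> w; rewrite /= lee_fin.
transitivity (\int[pushforward m X]_x (f x)%:E)%E.
  by rewrite ge0_integral_pushforward// => x _; rewrite lee_fin.
transitivity (\int[mscale c (distribution P X)]_x (f x)%:E)%E.
  apply: eq_measure_integral => A mA _.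
  transitivity (c%:num%:E * P (X @^-1` A))%E; last by [].
  rewrite -gX//. rewrite [LHS]mE integral_mkcond.
  apply: eq_integral => w _; rewrite patchE indicE.
  have -> : (w \in X @^-1` A) = (X w \in A) by apply/idP/idP; rewrite !inE.
  by case: (X w \in A); rewrite ?mulr1 ?mulr0.
rewrite ge0_integral_mscale//; last by move=> x _; rewrite lee_fin.
congr (_ * _)%E; by rewrite (ge0_integral_distribution X mEf fE0).
Qed.

(** Independence is given for events only; it is extended to functions one factor at a time. *)
Lemma integral_prod_independent d (T : measurableType d) (R : realType)
    (P : probability T R) (I : finType) (X : I -> {RV P >-> R})
    (f : I -> R -> R) (e : I -> R) :
  mutually_independent X ->
  (forall k, measurable_fun setT (f k)) -> (forall k x, 0 <= f k x) ->
  (forall k, (\int[P]_w (f k (X k w))%:E = (e k)%:E)%E) ->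
  (\int[P]_w (\prod_k f k (X k w))%:E = (\prod_k e k)%:E)%E.
Proof.
move=> indep mf f0 fe.
have mprod (h : I -> R -> R) (Q : pred I) :
    (forall k, measurable_fun setT (h k)) ->
    measurable_fun setT (fun w => \prod_(k | Q k) h k (X k w)).
  move=> mh; under eq_fun do rewrite -big_filter.
  by apply: measurable_prod => k _; exact: measurableT_comp.
have [s sP] : exists s : seq I, forall k, k \in s.
  by exists (enum I) => k; rewrite mem_enum.
(* Induction on the set of factors that are not indicators. *)
have main : forall (s : seq I) (f : I -> R -> R) (e : I -> R),
    (forall k, measurable_fun setT (f k)) -> (forall k x, 0 <= f k x) ->
    (forall k, (\int[P]_w (f k (X k w))%:E = (e k)%:E)%E) ->
    (forall k, k \notin s -> exists2 B, measurable B & f k = \1_B) ->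
    (\int[P]_w (\prod_k f k (X k w))%:E = (\prod_k e k)%:E)%E.
  elim=> [|k0 s' IH] {sP mf f0 fe e f} f e mf f0 fe fs.
    (* All factors are indicators here, so the product is the indicator of an intersection and
       independence over the full index set applies. *)
    have /choice[B BP] : forall k, exists B, measurable B /\ f k = \1_B.
      by move=> k; have [//|B mB fB] := fs k; exists B.
    have mB k : measurable (B k) by have [] := BP k.
    have fB k : f k = \1_(B k) by have [] := BP k.
    have mXB k : measurable (X k @^-1` B k).
      by rewrite -[_ @^-1` _]setTI; exact: (measurable_funP (X k)).
    have eB k : (e k)%:E = P (X k @^-1` B k).
      rewrite -fe -[X in P X]setIT -integral_indic//.
      by apply: eq_integral => w _; rewrite fB !indicE.
    transitivity (P (\bigcap_(k in [set` [set: I]%SET]) (X k @^-1` B k))).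
      rewrite -[X in P X]setIT -integral_indic//.
        apply: eq_integral => w _; rewrite indicE; congr (_%:E).
        have [wB|/negP wB] := boolP (w \in _).
          rewrite big1// => k _; rewrite fB indicE mem_set//.
          by move/set_mem : wB => /(_ k); apply; rewrite /= inE.
        apply/eqP/prodf_eq0.
        have [k kB] : exists k, ~ B k (X k w).
          apply/existsNP => h; apply: wB; rewrite inE => k _; exact: h.
        by exists k => //; rewrite fB indicE memNset.
      by apply: fin_bigcap_measurable => // k _.
    rewrite indep// -prodEFin; apply: eq_big => [k|k _]; first by rewrite inE.
    by rewrite eB.
  have e0 k : 0 <= e k.
    by rewrite -lee_fin -fe; apply: integral_ge0 => w _; rewrite lee_fin.
  have c0 : 0 <= \prod_(k | k != k0) e k by exact: prodr_ge0.
  have gm : measurable_fun setT (fun w => \prod_(k | k != k0) f k (X k w)).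
    exact: mprod.
  have gge0 w : 0 <= \prod_(k | k != k0) f k (X k w) by exact: prodr_ge0.
  (* With an indicator in place of [f k0], the induction hypothesis gives exactly the assumption of
     [integral_mul_factor]. *)
  have key : (\int[P]_w (\prod_(k | k != k0) f k (X k w) * f k0 (X k0 w))%:E =
     (NngNum c0)%:num%:E * \int[P]_w (f k0 (X k0 w))%:E)%E.
    apply: integral_mul_factor => // A mA.
    pose f' k := if k == k0 then \1_A else f k.
    pose e' k := if k == k0 then fine (P (X k0 @^-1` A)) else e k.
    have mXA : measurable (X k0 @^-1` A).
      by rewrite -[_ @^-1` _]setTI; exact: (measurable_funP (X k0)).
    transitivity (\int[P]_w (\prod_k f' k (X k w))%:E)%E.
      apply: eq_integral => w _; rewrite [in RHS](bigD1 k0)//= /f' eqxx mulrC.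
      by congr (_ * _)%:E; apply: eq_bigr => k /negPf ->.
    rewrite (IH f' e').
    - rewrite (bigD1 k0)//= {1}/e' eqxx EFinM fineK ?fin_num_measure//= muleC.
      by congr (_%:E * _)%E; apply: eq_bigr => k /negPf kk0; rewrite /e' kk0.
    - by move=> k; rewrite /f'; case: ifP.
    - by move=> k x; rewrite /f'; case: ifP => // _; rewrite indicE.
    - move=> k; rewrite /f' /e'; case: eqP => [->|//].
      rewrite fineK ?fin_num_measure// -[in RHS](setIT (_ @^-1` _)).
      by rewrite -integral_indic.
    - move=> k ks; rewrite /f'; case: eqP => [_|/eqP kk0]; first by exists A.
      by apply: fs; rewrite inE negb_or kk0.
  rewrite [in RHS](bigD1 k0)//= EFinM muleC -fe -key.
  by apply: eq_integral => w _; rewrite (bigD1 k0)//= mulrC.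
by apply: (main s) => // k; rewrite sP.
Qed.

Lemma lebesgue_measure_shift (R : realType) (a : R) (A : set R) :
  measurable A ->
  pushforward lebesgue_measure (+%R a : _ -> measurableTypeR R) A =
  lebesgue_measure A.
Proof.
move=> mA.
have ms : measurable_fun setT (+%R a : measurableTypeR R -> measurableTypeR R).
  exact: measurable_funD.
apply/esym/lebesgue_measure_unique => //= _ [[b c]] _ <-.
rewrite /pushforward.
have -> : +%R a @^-1` [set` `]b, c]] = [set` `]b - a, c - a]].
  by apply/seteqP; split => x /=; rewrite !in_itv/= ltrBlDl lerBrDl.
rewrite !lebesgue_measure_itv/= !lte_fin ltrD2r.
by case: ifP => // _; rewrite -!EFinB opprB addrA subrK.
Qed.

(* Completing the square turns the tilted N(0,1) density into that of N(a,1). *)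
Lemma normal_prob_shift (R : realType) (a : R) (A : set R) : measurable A ->
  (\int[normal_prob 0 1]_x (\1_A x * expR (a * x - a ^+ 2 / 2))%:E)%E =
  normal_prob 0 1 (+%R a @^-1` A).
Proof.
move=> mA.
have mpdf : measurable_fun setT (normal_pdf (0:R) 1).
  exact: measurable_normal_pdf.
have pdf0 x : 0 <= normal_pdf (0:R) 1 x by exact: normal_pdf_ge0.
pose h x : R := \1_A x * normal_pdf 0 1 (x - a).
have mh : measurable_fun setT h.
  apply: measurable_funM => //; apply: measurableT_comp => //.
  exact: measurable_funB.
transitivity (\int[lebesgue_measure]_x (h x)%:E)%E.
  rewrite (integral_weighted (mu := lebesgue_measure) mpdf pdf0)//.
  - apply: eq_integral => x _; rewrite -EFinM /h -mulrA; congr (_ * _)%:E.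
    rewrite !normal_pdfE ?oner_eq0// mulrCA; congr *%R.
    rewrite /normal_fun -expRD; congr expR; by field.
  - apply/measurable_EFinP; apply: measurable_funM => //.
    apply: measurableT_comp => //; exact: measurable_funB.
have ms : measurable_fun setT (+%R a : measurableTypeR R -> measurableTypeR R).
  exact: measurable_funD.
transitivity (\int[pushforward lebesgue_measure
    (+%R a : _ -> measurableTypeR R)]_x (h x)%:E)%E.
  apply: eq_measure_integral => B mB _.
  exact: (esym (lebesgue_measure_shift a mB)).
rewrite ge0_integral_pushforward//.
- rewrite /normal_prob [RHS]integral_mkcond; apply: eq_integral => x _.
  rewrite patchE /= /h addrAC subrr add0r indicE.
  have -> : (x \in +%R a @^-1` A) = (a + x \in A).
    by apply/idP/idP; rewrite !inE.
  by case: ifP; rewrite ?mul1r ?mul0r.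
- exact/measurable_EFinP.
- by move=> x _; rewrite lee_fin mulr_ge0.
Qed.

(** * The sigma-algebra on matrices *)

Section mx_measurable.
Variables (R : realType) (n p : nat).

(** The generator of [mx_sigma_algebra], named so that [g_sigma_algebraType] turns matrices into a
    measurable type. *)
Definition mx_cylinder : set (set 'M[R]_(n, p)) :=
  [set A | exists i j (B : set R), measurable B /\
     A = (fun X : 'M[R]_(n, p) => X i j) @^-1` B].

(** Unlike the cylinders, these sets are stable under intersection: they are the pi-system on which
    measures get compared. *)
Definition mx_rectangle : set (set 'M[R]_(n, p)) :=
  [set A | exists2 B : 'I_n -> 'I_p -> set R,
     forall i j, measurable (B i j) &
     A = [set X : 'M[R]_(n, p) | forall i j, B i j (X i j)]].

Lemma mx_rectangleT : mx_rectangle setT.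
Proof.
exists (fun _ _ => setT) => //.
by apply/seteqP; split => [X _ i j|].
Qed.

Lemma mx_rectangle_setI : setI_closed mx_rectangle.
Proof.
move=> _ _ [B mB ->] [C mC ->]; exists (fun i j => B i j `&` C i j).
  by move=> i j; exact: measurableI.
apply/seteqP; split => [X [BX CX] i j //=|X BC].
by split => i j; have [] := BC i j.
Qed.

Lemma mx_cylinder_sub_rectangle : mx_cylinder `<=` mx_rectangle.
Proof.
move=> _ [i [j [B [mB ->]]]].
exists (fun i' j' => if (i' == i) && (j' == j) then B else setT).
  by move=> i' j'; case: ifP => // _; exact: measurableT.
apply/seteqP; split => [X BX i' j' /=|X /(_ i j)]; last by rewrite !eqxx.
by case: ifP => // /andP[/eqP -> /eqP ->].
Qed.

Local Notation M := (g_sigma_algebraType mx_cylinder).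

Lemma measurable_mx_rectangle (A : set M) : mx_rectangle A -> measurable A.
Proof.
move=> [B mB ->].
have -> : [set X : 'M[R]_(n, p) | forall i j, B i j (X i j)] =
    \bigcap_(i in [set` [set: 'I_n]%SET]) \bigcap_(j in [set` [set: 'I_p]%SET])
      ((fun X : 'M[R]_(n, p) => X i j) @^-1` B i j).
  apply/seteqP; split => [X BX i _ j _|X BX i j]; first exact: BX.
  by apply: BX; rewrite /= inE.
apply: fin_bigcap_measurable => // i _; apply: fin_bigcap_measurable => // j _.
by apply: sub_sigma_algebra; exists i, j, (B i j).
Qed.

Lemma measurable_mx_fun d (T : measurableType d) (X : T -> M) :
  (forall i j, measurable_fun setT (fun w => (X w : 'M[R]_(n, p)) i j)) ->
  measurable_fun setT X.
Proof.
move=> mX; apply: (@measurability _ _ _ _ setT X mx_cylinder) => //.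
move=> _ [_ [i [j [B [mB ->]]]] <-].
by apply: mX.
Qed.

Lemma mx_measure_unique (m1 m2 : {measure set M -> \bar R}) :
  (forall A : set M, mx_rectangle A -> m1 A = m2 A) -> (m1 setT < +oo)%E ->
  forall A, mx_sigma_algebra A -> m1 A = m2 A.
Proof.
move=> m12 m1oo A mA.
have mrect : mx_rectangle `<=` (measurable : set (set M)).
  exact: measurable_mx_rectangle.
apply: (@g_sigma_algebra_measure_unique _ R M mx_rectangle mrect
  (fun=> setT)) => //.
- by move=> _; exact: mx_rectangleT.
- by rewrite bigcup_const.
- exact: mx_rectangle_setI.
- have := sub_smallest2r _ mx_cylinder_sub_rectangle; apply => //.
Qed.

End mx_measurable.

(** * The law of the data *)

Section change_of_measure.
Variables (R : realType) (d : measure_display) (T : measurableType d).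
Variables (P : probability T R) (n p : nat).
Variables (mu : 'I_p -> {RV P >-> R}) (ell : 'I_n -> {RV P >-> R}).
Variable Z : 'I_n -> 'I_p -> {RV P >-> R}.
Variables (alpha beta : R).
Hypothesis model : ARW_model mu ell Z alpha beta.
Local Notation M := (g_sigma_algebraType (@mx_cylinder R n p)).

Definition noise (w : T) : 'M[R]_(n, p) := \matrix_(i, j) Z i j w.

(* Density of N(a, 1) with respect to N(0, 1), entry by entry. *)
Definition tilt (a X : 'M[R]_(n, p)) : R :=
  \prod_i \prod_j expR (a i j * X i j - a i j ^+ 2 / 2).

Lemma tilt_ge0 a X : 0 <= tilt a X.
Proof. by do 2!apply: prodr_ge0 => ? _; exact: expR_ge0. Qed.

Lemma measurable_noise : measurable_fun setT (noise : T -> M).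
Proof.
apply: measurable_mx_fun => i j; under eq_fun do rewrite mxE.
exact: measurable_funP.
Qed.

Lemma observationE w i j :
  observation mu ell Z w i j = ell i w * mu j w + Z i j w.
Proof. by rewrite !mxE big_ord1 !mxE. Qed.

Lemma measurable_observation :
  measurable_fun setT (observation mu ell Z : T -> M).
Proof.
apply: measurable_mx_fun => i j; under eq_fun do rewrite observationE.
by apply: measurable_funD => //; exact: measurable_funM.
Qed.

Lemma measurable_tilt_noise a : measurable_fun setT (fun w => tilt a (noise w)).
Proof.
rewrite /tilt; apply: measurable_prod => i _; apply: measurable_prod => j _.
apply: measurableT_comp => //; apply: measurable_funB => //.
apply: measurable_funM => //; under eq_fun do rewrite mxE.
exact: measurable_funP.
Qed.

(** The integrand is a product over independent entries, and each factor is a Gaussian shifted by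
    [a i j]. *)
Lemma integral_indic_tilt_noise (a : 'M[R]_(n, p)) (B : 'I_n -> 'I_p -> set R) :
  (forall i j, measurable (B i j)) ->
  (\int[P]_w ((\prod_i \prod_j \1_(B i j) (Z i j w)) * tilt a (noise w))%:E =
   (\prod_i \prod_j fine (P (Z i j @^-1` (+%R (a i j) @^-1` B i j))))%:E)%E.
Proof.
move=> mB.
(* Independence concerns the joint family of [mu], [ell] and [Z], so the first two receive the
   constant factor 1. *)
pose f (k : 'I_p + 'I_n + 'I_n * 'I_p) : R -> R := match k with
  | inl _ => cst 1
  | inr (i, j) =>
      fun x => \1_(B i j) x * expR (a i j * x - a i j ^+ 2 / 2) end.
pose e (k : 'I_p + 'I_n + 'I_n * 'I_p) : R := match k with
  | inl _ => 1
  | inr (i, j) => fine (P (Z i j @^-1` (+%R (a i j) @^-1` B i j))) end.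
have mshift i j : measurable (+%R (a i j) @^-1` B i j).
  have ms : measurable_fun setT (+%R (a i j) : R -> R).
    exact: measurable_funD.
  by rewrite -[_ @^-1` _]setTI; exact: ms.
have := @integral_prod_independent _ _ _ P _ (arw_entry mu ell Z) f e
  (ARW_indep model).
rewrite [X in _ -> _ -> _ -> _ = X%:E]big_sumType /=.
rewrite [X in _ -> _ -> _ -> _ = (X * _)%:E]big1 ?mul1r; last by case.
rewrite pair_big /= => H.
transitivity (\int[P]_w (\prod_k f k (arw_entry mu ell Z k w))%:E)%E.
  apply: eq_integral => w _; congr EFin.
  rewrite big_sumType /= [X in _ = X * _]big1 ?mul1r; last by case.
  rewrite /tilt pair_big /= [X in _ * X]pair_big -big_split /=.
  by apply: eq_bigr => -[i j] _ /=; rewrite mxE.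
have mf k : measurable_fun setT (f k).
  case: k => [_|[i j]] /=; first exact: measurable_cst.
  by apply: measurable_funM => //; apply: measurableT_comp => //;
    apply: measurable_funB => //; exact: measurable_funM.
have f0 k x : 0 <= f k x.
  by case: k => [_|[i j]] //=; rewrite mulr_ge0// expR_ge0.
rewrite H//.
- by congr EFin; apply: eq_bigr => -[].
- move=> [k|[i j]] /=.
    by rewrite integral_cst// mul1e; exact: probability_setT.
  have pZ : forall A, measurable A -> P (Z i j @^-1` A) = normal_prob 0 1 A.
    exact: (ARW_Z model).
  rewrite pZ// fineK; last by apply: fin_num_measure; exact: mshift.
  rewrite -normal_prob_shift//.
  pose g x : \bar R := (\1_(B i j) x * expR (a i j * x - a i j ^+ 2 / 2))%:E.
  have mZ : measurable_fun setT (Z i j : T -> measurableTypeR R).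
    exact: (measurable_funP (Z i j)).
  transitivity (\int[pushforward P (Z i j : T -> measurableTypeR R)]_x g x)%E.
    rewrite ge0_integral_pushforward//.
    + apply/measurable_EFinP; exact: (mf (inr (i, j))).
    + by move=> x _; rewrite lee_fin; exact: (f0 (inr (i, j))).
  by apply: eq_measure_integral => A mA _; exact: (ARW_Z model).
Qed.

(** Once [mu = u] and [ell = s] are fixed, the data are the noise shifted by a constant matrix. Both
    sides are finite measures in [B], so it suffices to compare them on rectangles, where
    independence computes each. *)
Lemma ARW_change_of_measure (u : 'I_p -> R) (s : 'I_n -> R) (B : set M) :
  measurable B ->
  P [set w | [/\ forall j, mu j w = u j, forall i, ell i w = s i
             & B (observation mu ell Z w)]] =
  ((\prod_j fine (P (mu j @^-1` [set u j])) *
    \prod_i fine (P (ell i @^-1` [set s i])))%:E *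
   \int[P]_w (\1_B (noise w) * tilt (\matrix_(i, j) (s i * u j)) (noise w))%:E)%E.
Proof.
move=> mB; set a := \matrix_(i, j) _; set c := _ * _.
have c0 : 0 <= c.
  by rewrite mulr_ge0//; apply: prodr_ge0 => k _; exact: fine_ge0.
pose E := [set w | (forall j, mu j w = u j) /\ (forall i, ell i w = s i)].
have mE : measurable E.
  have -> : E = \bigcap_(j in [set` [set: 'I_p]%SET]) (mu j @^-1` [set u j]) `&`
      \bigcap_(i in [set` [set: 'I_n]%SET]) (ell i @^-1` [set s i]).
    apply/seteqP; split=> [w [wm wl]|w [wm wl]]; split=> k.
    - by move=> _; exact: wm.
    - by move=> _; exact: wl.
    - by apply: wm; rewrite /= inE.
    - by apply: wl; rewrite /= inE.
  by apply: measurableI; exact: fin_bigcap_measurable.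
have mobs := measurable_observation; have mnoise := measurable_noise.
have mt := measurable_tilt_noise a.
have mct : measurable_fun setT (fun w => c * tilt a (noise w)).
  exact: measurable_funM.
have ct0 w : 0 <= c * tilt a (noise w) by rewrite mulr_ge0// tilt_ge0.
have [m mP] := weighted_measure P mct ct0.
have [m1 m1P] : exists m1 : {measure set M -> \bar R},
    forall A, m1 A = P (observation mu ell Z @^-1` A `&` E).
  by exists (pushforward (mrestr P mE) (observation mu ell Z : T -> M)).
have [m2 m2P] : exists m2 : {measure set M -> \bar R},
    forall A, m2 A = m (noise @^-1` A).
  by exists (pushforward m (noise : T -> M)).
have m1E A : m1 A = P [set w | [/\ forall j, mu j w = u j,
    forall i, ell i w = s i & A (observation mu ell Z w)]].
  rewrite m1P; congr (P _).
  by apply/seteqP; split => [w [/= ? []]|w [? ? ?]].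
have m2E A : measurable A ->
    m2 A = (c%:E * \int[P]_w (\1_A (noise w) * tilt a (noise w))%:E)%E.
  move=> mA; rewrite m2P mP integral_mkcond -ge0_integralZl//=.
  - apply: eq_integral => w _; rewrite patchE indicE.
    have -> : (w \in noise @^-1` A) = (noise w \in A).
      by apply/idP/idP; rewrite !inE.
    by case: ifP => _ /=; rewrite ?(mul1r, mul0r, mulr0, mule0) ?EFinM.
  - apply/measurable_EFinP; apply: measurable_funM => //.
    have mI : measurable_fun setT (\1_A : M -> R) by exact: measurable_indic.
    exact: (measurableT_comp mI mnoise).
  - by move=> w _; rewrite lee_fin mulr_ge0// tilt_ge0.
rewrite -m1E -m2E//; apply: mx_measure_unique => //; last first.
  rewrite m1P preimage_setT setTI.
  exact: le_lt_trans (probability_le1 P mE) (ltry 1).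
move=> _ [C mC ->]; rewrite m1E m2E; last first.
  by apply: measurable_mx_rectangle; exists C.
transitivity (c%:E * \int[P]_w ((\prod_i \prod_j \1_(C i j) (Z i j w)) *
    tilt a (noise w))%:E)%E; last first.
  congr (_ * _)%E; apply: eq_integral => w _; congr (_ * _)%:E.
  rewrite indicE; have [wC|/negP wC] := boolP (noise w \in _).
    rewrite big1// => i _; rewrite big1// => j _; rewrite indicE mem_set//.
    by move/set_mem : wC => /(_ i j); rewrite mxE.
  have [i [j wij]] : exists i j, ~ C i j (Z i j w).
    apply: contrapT => h; apply: wC; rewrite inE => i j; rewrite mxE.
    by apply: contrapT => hij; apply: h; exists i, j.
  rewrite (bigD1 i)//= (bigD1 j)//= indicE memNset//.
  by rewrite !mul0r.
rewrite integral_indic_tilt_noise// -EFinM.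
(* On a rectangle the event constrains each variable separately: the noise entry must land in
   [C i j] after the shift by [a i j]. *)
pose B' (k : 'I_p + 'I_n + 'I_n * 'I_p) : set R := match k with
  | inl (inl j) => [set u j] | inl (inr i) => [set s i]
  | inr (i, j) => +%R (a i j) @^-1` C i j end.
have mB' k : measurable (B' k).
  case: k => [[j|i]|[i j]] /=; [exact: measurable_set1|exact: measurable_set1|].
  have ms : measurable_fun setT (+%R (a i j) : R -> R).
    exact: measurable_funD.
  by rewrite -[_ @^-1` _]setTI; exact: ms.
transitivity (P (\bigcap_(k in [set` [set: 'I_p + 'I_n + 'I_n * 'I_p]%SET])
    (arw_entry mu ell Z k @^-1` B' k))).
  congr (P _); apply/seteqP; split => [w [wm wl wC] [[j|i]|[i j]] _ /=|w wB].
  - exact: wm.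
  - exact: wl.
  - by have := wC i j; rewrite observationE mxE wm wl.
  - have wm j : mu j w = u j by apply: (wB (inl (inl j))); rewrite /= inE.
    have wl i : ell i w = s i by apply: (wB (inl (inr i))); rewrite /= inE.
    split => // i j; rewrite observationE wm wl.
    by have := wB (inr (i, j)); rewrite /= inE mxE; apply.
rewrite (ARW_indep model)//.
have mXB k : measurable (arw_entry mu ell Z k @^-1` B' k).
  by rewrite -[_ @^-1` _]setTI; exact: (measurable_funP (arw_entry mu ell Z k)).
transitivity (\prod_k fine (P (arw_entry mu ell Z k @^-1` B' k)))%:E.
  rewrite -prodEFin; apply: eq_big => [k|k _]; first by rewrite inE.
  by rewrite fineK// fin_num_measure.
by rewrite !big_sumType /= pair_big; congr (_ * _)%:E; apply: eq_bigr => -[].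
Unshelve. all: by [].
Qed.

End change_of_measure.

(** * Averaging out the signs *)

Section gaussian_rows.
Variables (R : realType) (d : measure_display) (T : measurableType d).
Variables (P : probability T R) (n p : nat).
Variables (mu : 'I_p -> {RV P >-> R}) (ell : 'I_n -> {RV P >-> R}).
Variable Z : 'I_n -> 'I_p -> {RV P >-> R}.
Variables (alpha beta : R).
Hypothesis model : ARW_model mu ell Z alpha beta.
Local Notation noise := (noise Z).

Lemma integral_tilt_noise (a : 'M[R]_(n, p)) :
  (\int[P]_w (tilt a (noise w))%:E)%E = 1%E.
Proof.
have H := integral_indic_tilt_noise model a (B := fun _ _ => setT)
  (fun _ _ => measurableT).
transitivity (\prod_(i < n) \prod_(j < p) fine (P (Z i j @^-1`
    (+%R (a i j) @^-1` [set: R]))))%:E; last first.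
  congr EFin; rewrite big1// => i _; rewrite big1// => j _.
  by rewrite (_ : _ @^-1` _ = setT) ?probability_setT.
rewrite -H; apply: eq_integral => w _; congr EFin.
rewrite big1 ?mul1r// => i _; rewrite big1// => j _.
by rewrite indicE in_setT.
Qed.

Lemma integrable_tilt_noise (a : 'M[R]_(n, p)) :
  P.-integrable setT (fun w => (tilt a (noise w))%:E).
Proof.
apply/integrableP; split.
  by apply/measurable_EFinP; exact: measurable_tilt_noise.
under eq_integral do rewrite /= ger0_norm ?tilt_ge0//.
by rewrite integral_tilt_noise ltry.
Qed.

(** Expanding the product gives a sum over choices of one [k] per row; completing squares makes each
    term a constant times a [tilt], of integral 1. The [c k] may be negative, as some of [chi2_coef]
    are, hence the recourse to integrability. *)
Lemma integral_prod_rows (K : finType) (c : K -> R) (v : K -> 'I_p -> R) :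
  (\int[P]_w (\prod_i \sum_k c k * expR (\sum_j v k j * noise w i j))%:E =
   ((\sum_k c k * expR (\sum_j v k j ^+ 2 / 2)) ^+ n)%:E)%E.
Proof.
pose C k := c k * expR (\sum_j v k j ^+ 2 / 2).
pose a (s : {ffun 'I_n -> K}) : 'M[R]_(n, p) := \matrix_(i, j) v (s i) j.
have rowE w : \prod_i \sum_k c k * expR (\sum_j v k j * noise w i j) =
    \sum_(s : {ffun 'I_n -> K}) (\prod_i C (s i)) * tilt (a s) (noise w).
  rewrite bigA_distr_bigA; apply: eq_bigr => s _.
  rewrite /tilt -big_split/=; apply: eq_bigr => i _.
  rewrite -expR_sum /C -mulrA -expRD; congr (_ * expR _).
  rewrite -big_split/=; apply: eq_bigr => j _; rewrite [a s i j]mxE.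
  by rewrite addrC subrK.
under eq_integral do rewrite rowE -sumEFin.
rewrite integral_sum//; last first.
  move=> s; under eq_fun do rewrite EFinM.
  by apply: integrableZl => //; exact: integrable_tilt_noise.
under eq_bigr => s _.
  under eq_integral do rewrite EFinM.
  rewrite integralZl//; last exact: integrable_tilt_noise.
  rewrite integral_tilt_noise mule1.
  over.
rewrite sumEFin; congr EFin.
rewrite -(bigA_distr_bigA (fun (_ : 'I_n) k => C k)) /=.
by rewrite prodr_const card_ord.
Qed.

(** Boolean signs make the sign vectors a finite type to sum over. *)
Definition sgnb (b : bool) : R := (-1) ^+ b.

(** The hyperbolic cosine. *)
Definition chR (x : R) : R := (expR x + expR (- x)) / 2.

Lemma chR_gt0 x : 0 < chR x.
Proof. by rewrite divr_gt0// addr_gt0// expR_gt0. Qed.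

(* The density, with respect to the noise, of the data given [mu = u], the
   signs being averaged out. *)
Definition mixture (u : 'I_p -> R) (X : 'M[R]_(n, p)) : R :=
  \prod_i (expR (- (\sum_j u j ^+ 2) / 2) * chR (\sum_j u j * X i j)).

Lemma mixture_gt0 u X : 0 < mixture u X.
Proof. by apply: prodr_gt0 => i _; rewrite mulr_gt0 ?expR_gt0 ?chR_gt0. Qed.

(** The average over signs factorises over rows. In a row the two signs share the Gaussian
    normalisation, and their exponentials average to a hyperbolic cosine. *)
Lemma mixtureE u X : mixture u X = (2^-1) ^+ n *
  \sum_(s : {ffun 'I_n -> bool}) tilt (\matrix_(i, j) (sgnb (s i) * u j)) X.
Proof.
have half : (2^-1 : R) ^+ n = \prod_(i < n) 2^-1 by rewrite prodr_const card_ord.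
rewrite big_distrr/=.
transitivity (\prod_(i < n) \sum_(b : bool) 2^-1 *
    expR (\sum_j (sgnb b * u j * X i j - u j ^+ 2 / 2))).
  apply: eq_bigr => i _.
  have sumE (b : bool) : \sum_j (sgnb b * u j * X i j - u j ^+ 2 / 2) =
      - (\sum_j u j ^+ 2) / 2 + sgnb b * \sum_j u j * X i j.
    rewrite big_split/= sumrN mulr_sumr mulNr mulr_suml addrC.
    by congr (_ + _); apply: eq_bigr => j _; rewrite mulrA.
  rewrite big_bool !sumE /sgnb /= expr1 expr0 mulN1r mul1r !expRD /chR.
  by field.
rewrite bigA_distr_bigA; apply: eq_bigr => s _; rewrite half /tilt -big_split/=.
apply: eq_bigr => i _; congr *%R; rewrite expR_sum; apply: eq_bigr => j _.
congr expR; rewrite mxE exprMn /sgnb.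
by rewrite -exprM mulnC exprM sqrrN expr1n expr1n mul1r.
Qed.

Lemma integral_mixture_noise u : (\int[P]_w (mixture u (noise w))%:E)%E = 1%E.
Proof.
under eq_integral do rewrite mixtureE EFinM -sumEFin.
rewrite integralZl//; last first.
  by apply: integrable_sum => //= s _; exact: integrable_tilt_noise.
rewrite integral_sum//; last by move=> s; exact: integrable_tilt_noise.
under eq_bigr do rewrite integral_tilt_noise.
rewrite sumEFin -EFinM; congr EFin.
rewrite sumr_const card_ffun card_bool card_ord natrX.
by rewrite -exprMn mulVf ?expr1n// pnatr_eq0.
Qed.

End gaussian_rows.

(** * Second moment of the likelihood ratio *)

Section chi2.
Variables (R : realType) (d : measure_display) (T : measurableType d).
Variables (P : probability T R) (n p : nat).
Variables (mu : 'I_p -> {RV P >-> R}) (ell : 'I_n -> {RV P >-> R}).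
Variable Z : 'I_n -> 'I_p -> {RV P >-> R}.
Variables (alpha beta : R).
Hypothesis model : ARW_model mu ell Z alpha beta.
Local Notation noise := (noise Z).

(* The expansion, as a combination of exponentials, of
   [cosh y cosh^2 t + 2 sinh y sinh t cosh t + (2 cosh y - 2) sinh^2 t]: this is
   [cosh^2 (y + t) / cosh y] with [sinh^2 y / cosh y] replaced by its upper bound
   [2 cosh y - 2]. *)
Definition chi2_coef : seq R :=
  [:: 5 / 8; 1 / 8; 1 / 8; 5 / 8; - (1 / 4); - (1 / 4); - (1 / 2); - (1 / 2); 1].

Definition chi2_dir : seq (R * R) :=
  [:: (1, 2); (1, -2); (-1, 2); (-1, -2); (1, 0); (-1, 0); (0, 2); (0, -2);
      (0, 0)].

(* With x = e^y and z = e^t, the difference of the two sides is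
   (sinh t (cosh y - 1))^2, because cosh^2 = 1 + sinh^2. *)
Lemma chR_sqr_le (y t : R) :
  chR (y + t) ^+ 2 <= chR y *
    \sum_(k < 9) chi2_coef`_k *
      expR ((nth 0 chi2_dir k).1 * y + (nth 0 chi2_dir k).2 * t).
Proof.
rewrite !big_ord_recl big_ord0 /chi2_coef /chi2_dir /= /chR.
rewrite !(mul1r, mul0r, addr0, add0r, mulN1r, opprD, mulNr) expR0.
have y2 : 2 * t = t + t by rewrite mulrDl mul1r.
rewrite y2 !opprD !expRD !expRN.
have := expR_gt0 y; have := expR_gt0 t.
move: (expR y) (expR t) => x z z0 x0.
have x1 : x != 0 by rewrite gt_eqF.
have z1 : z != 0 by rewrite gt_eqF.
rewrite -subr_ge0 (_ : _ - _ =
  ((z - z^-1) / 2 * ((x + x^-1) / 2 - 1)) ^+ 2) ?sqr_ge0//.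
field.
by rewrite x1 z1.
Qed.

Variables (u v : 'I_p -> R) (j : 'I_p) (t : R).
Hypotheses (uj : u j = 0) (vj : v j = t) (uv : forall k, k != j -> v k = u k).
Let S := \sum_k u k ^+ 2.

(** The exponential is what the Gaussian normalisations leave in a row of the ratio:
    [exp (- (S + t^2) / 2)] squared, over [exp (- S / 2)]. *)
Definition chi2_weight (k : 'I_9) : R := expR (- S / 2 - t ^+ 2) * chi2_coef`_k.

(** The coefficient vector of the linear form [a * y + b * (t * X i j)], with [(a, b)] the [k]-th
    direction and [y] the product of [u] with row [i]. *)
Definition chi2_shift (k : 'I_9) (l : 'I_p) : R :=
  (nth 0 chi2_dir k).1 * u l + (nth 0 chi2_dir k).2 * (if l == j then t else 0).

Let sum_split (F : R -> 'I_p -> R) : (forall l, F 0 l = 0) ->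
  \sum_l F (v l) l = \sum_l F (u l) l + F t j.
Proof.
move=> F0; rewrite (bigD1 j)//= [in RHS](bigD1 j)//= uj vj F0 add0r addrC.
by congr (_ + _); apply: eq_bigr => l /uv ->.
Qed.

Let sum_delta (F : 'I_p -> R) : \sum_l (if l == j then t else 0) * F l = t * F j.
Proof.
rewrite (bigD1 j)//= eqxx big1 ?addr0// => l /negPf ->.
by rewrite mul0r.
Qed.

(** The exact ratio has a hyperbolic cosine in its denominator; this bound on it is a combination of
    exponentials of linear forms, which [integral_prod_rows] integrates in closed form. *)
Lemma mixture_sqr_le (X : 'M[R]_(n, p)) : mixture v X ^+ 2 <=
  mixture u X * \prod_i \sum_k chi2_weight k * expR (\sum_l chi2_shift k l * X i l).
Proof.
rewrite /mixture -prodrXl -big_split/=; apply: ler_prod => i _.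
rewrite sqr_ge0/=.
have -> : \sum_l v l * X i l = \sum_l u l * X i l + t * X i j.
  by rewrite (sum_split (F := fun a l => a * X i l))// => l; rewrite mul0r.
have -> : \sum_l v l ^+ 2 = S + t ^+ 2.
  by rewrite (sum_split (F := fun a l => a ^+ 2))// => l; rewrite expr0n.
rewrite -/S; set y := \sum_l _.
have -> : \sum_k chi2_weight k * expR (\sum_l chi2_shift k l * X i l) =
    expR (- S / 2 - t ^+ 2) * \sum_(k < 9) chi2_coef`_k *
      expR ((nth 0 chi2_dir k).1 * y + (nth 0 chi2_dir k).2 * (t * X i j)).
  rewrite mulr_sumr; apply: eq_bigr => k _; rewrite /chi2_weight -!mulrA.
  congr (_ * (_ * expR _)); rewrite /chi2_shift /y.
  under eq_bigr do rewrite mulrDl -!mulrA.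
  by rewrite big_split/= -!mulr_sumr sum_delta.
rewrite exprMn [leRHS]mulrACA -expRM_natl -expRD.
rewrite (_ : - S / 2 + (- S / 2 - t ^+ 2) = 2%:R * (- (S + t ^+ 2) / 2));
  last by field.
by rewrite ler_pM2l ?expR_gt0//; exact: chR_sqr_le.
Qed.

(* Equal to [cosh x + 2 (1 - exp (- q / 2)) sinh x]. *)
Definition chi2_row (q x : R) : R :=
  3 / 2 * expR x - expR (- x) / 2 - expR (- q / 2) * (expR x - expR (- x)).

Lemma chi2_rowE :
  \sum_k chi2_weight k * expR (\sum_l chi2_shift k l ^+ 2 / 2) =
  chi2_row S (t ^+ 2).
Proof.
(* Since [u j = 0], the two components of a shift are orthogonal and their squared norms add up. *)
have shiftE k : \sum_l chi2_shift k l ^+ 2 / 2 =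
    (nth 0 chi2_dir k).1 ^+ 2 * (S / 2) + (nth 0 chi2_dir k).2 ^+ 2 * (t ^+ 2 / 2).
  rewrite -mulr_suml (bigD1 j)//= /chi2_shift eqxx uj mulr0 add0r.
  rewrite (eq_bigr (fun l => (nth 0 chi2_dir k).1 ^+ 2 * u l ^+ 2)); last first.
    by move=> l /negPf ->; rewrite mulr0 addr0 exprMn.
  rewrite -mulr_sumr /S [in RHS](bigD1 j)//= uj expr0n add0r.
  by rewrite exprMn addrC mulrDl -!mulrA.
under eq_bigr do rewrite shiftE.
rewrite !big_ord_recl big_ord0 /chi2_weight /chi2_coef /chi2_dir /chi2_row /=.
have -> : - S / 2 - t ^+ 2 = - (S / 2) - t ^+ 2 by rewrite mulNr.
have -> : 1 ^+ 2 * (S / 2) + 2 ^+ 2 * (t ^+ 2 / 2) = S / 2 + (t ^+ 2 + t ^+ 2).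
  by field.
have -> : 1 ^+ 2 * (S / 2) + (-2) ^+ 2 * (t ^+ 2 / 2) = S / 2 + (t ^+ 2 + t ^+ 2).
  by field.
have -> : (-1) ^+ 2 * (S / 2) + 2 ^+ 2 * (t ^+ 2 / 2) = S / 2 + (t ^+ 2 + t ^+ 2).
  by field.
have -> : (-1) ^+ 2 * (S / 2) + (-2) ^+ 2 * (t ^+ 2 / 2) = S / 2 + (t ^+ 2 + t ^+ 2).
  by field.
have -> : 1 ^+ 2 * (S / 2) + 0 ^+ 2 * (t ^+ 2 / 2) = S / 2 by field.
have -> : (-1) ^+ 2 * (S / 2) + 0 ^+ 2 * (t ^+ 2 / 2) = S / 2 by field.
have -> : 0 ^+ 2 * (S / 2) + 2 ^+ 2 * (t ^+ 2 / 2) = t ^+ 2 + t ^+ 2 by field.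
have -> : 0 ^+ 2 * (S / 2) + (-2) ^+ 2 * (t ^+ 2 / 2) = t ^+ 2 + t ^+ 2 by field.
have -> : 0 ^+ 2 * (S / 2) + 0 ^+ 2 * (t ^+ 2 / 2) = 0 :> R by field.
rewrite mulNr expR0 !expRD !expRN.
have := expR_gt0 (S / 2); have := expR_gt0 (t ^+ 2).
move: (expR (S / 2)) (expR (t ^+ 2)) => y z z0 y0.
field.
by rewrite !gt_eqF.
Qed.

Lemma integral_chi2_noise :
  (\int[P]_w (\prod_i \sum_k chi2_weight k *
    expR (\sum_l chi2_shift k l * noise w i l))%:E =
   (chi2_row S (t ^+ 2) ^+ n)%:E)%E.
Proof. by rewrite (integral_prod_rows model) chi2_rowE. Qed.

End chi2.

(** * Lower bound on the Hamming loss *)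

Section risk.
Variables (R : realType) (d : measure_display) (T : measurableType d).
Variables (P : probability T R) (n p : nat).
Variables (mu : 'I_p -> {RV P >-> R}) (ell : 'I_n -> {RV P >-> R}).
Variable Z : 'I_n -> 'I_p -> {RV P >-> R}.
Variables (alpha beta : R).
Hypothesis model : ARW_model mu ell Z alpha beta.
Variable Shat : 'M[R]_(n, p) -> {set 'I_p}.
Hypothesis mShat : measurable_estimate Shat.
Local Notation noise := (noise Z).
Local Notation obs := (observation mu ell Z).
Local Notation M := (g_sigma_algebraType (@mx_cylinder R n p)).
Local Notation t := (tau alpha p).
Local Notation e := (eps beta p).
Hypothesis t_neq0 : t != 0.

Definition pattern (b : {ffun 'I_p -> bool}) (j : 'I_p) : R :=
  if b j then t else 0.

Definition prior (b : {ffun 'I_p -> bool}) : R :=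
  \prod_j (if b j then e else 1 - e).

(** Here [c] is the truth about the membership of [j] in the support. *)
Definition error_set (j : 'I_p) (c : bool) : set M :=
  [set X | (j \in Shat X) != c].

Lemma measurable_error_set j c : measurable (error_set j c).
Proof. exact: (mShat [set A : {set 'I_p} | (j \in A) != c]). Qed.

Let event (b : {ffun 'I_p -> bool}) (s : {ffun 'I_n -> bool}) (j : 'I_p) :=
  [set w | [/\ forall j, mu j w = pattern b j, forall i, ell i w = sgnb R (s i)
     & error_set j (b j) (obs w)]].

Let miss (j : 'I_p) := [set w | (j \in Shat (obs w)) != (mu j w != 0)].

Let measurable_RV_set1 (Y : {RV P >-> R}) (x : R) : measurable [set w | Y w = x].
Proof.
rewrite -[X in measurable X]setTI.
exact: (measurable_funP Y _ _ (measurable_set1 x)).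
Qed.

Let measurable_obs_error j c : measurable [set w | error_set j c (obs w)].
Proof.
rewrite -[X in measurable X]setTI.
exact: measurable_observation measurableT _ (measurable_error_set j c).
Qed.

Let measurable_event b s j : measurable (event b s j).
Proof.
have -> : event b s j =
    \bigcap_(k in [set` [set: 'I_p]%SET]) [set w | mu k w = pattern b k] `&`
    (\bigcap_(i in [set` [set: 'I_n]%SET]) [set w | ell i w = sgnb R (s i)] `&`
     [set w | error_set j (b j) (obs w)]).
  apply/seteqP; split => [w [wm wl we]|w [wm [wl we]]].
    by split=> [k _|]; [exact: wm|split => // i _; exact: wl].
  by split => // k; [apply: wm|apply: wl]; rewrite /= inE.
apply: measurableI; first exact: fin_bigcap_measurable.
by apply: measurableI => //; exact: fin_bigcap_measurable.
Qed.

Let measurable_miss j : measurable (miss j).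
Proof.
have -> : miss j = ([set w | mu j w = 0] `&` [set w | error_set j false (obs w)])
    `|` (~` [set w | mu j w = 0] `&` [set w | error_set j true (obs w)]).
  apply/seteqP; split => [w|w]; rewrite /miss /error_set /=.
    have [m0|/eqP m0] := eqVneq (mu j w) 0; first by left.
    by right; split => //; exact/eqP.
  by move=> [[/eqP -> //]|[/eqP -> //]].
apply: measurableU; apply: measurableI => //.
exact: measurableC.
Qed.

Let PE (b : {ffun 'I_p -> bool}) s j : P (event b s j) =
  ((prior b * 2^-1 ^+ n)%:E * \int[P]_w (\1_(error_set j (b j)) (noise w) *
    tilt (\matrix_(i, k) (sgnb R (s i) * pattern b k)) (noise w))%:E)%E.
Proof.
rewrite /event (ARW_change_of_measure model _ _ (measurable_error_set _ _)).
congr (_%:E * _)%E; congr (_ * _).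
  apply: eq_bigr => k _; rewrite /pattern.
  by case: (b k); rewrite ?(ARW_mu_tau model) ?(ARW_mu_0 model).
rewrite (eq_bigr (fun=> 2^-1)) ?prodr_const ?card_ord// => i _.
rewrite /sgnb; case: (s i).
  by rewrite expr1 (ARW_ell_N1 model).
by rewrite expr0 (ARW_ell_1 model).
Qed.

Lemma measurable_indic_noise j c (g : T -> R) : measurable_fun setT g ->
  measurable_fun setT (fun w => \1_(error_set j c) (noise w) * g w).
Proof.
move=> mg; apply: measurable_funM => //.
have mI : measurable_fun setT (\1_(error_set j c) : M -> R).
  by apply: measurable_indic; exact: measurable_error_set.
exact: (measurableT_comp mI (measurable_noise Z)).
Qed.

(** The loss counts the events [miss j], and [miss j] contains the pairwise disjoint events
    [event b s j]. Their probabilities come from the change of measure, and summing over [s] turns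
    the tilts into [mixture]. *)
Lemma expected_loss_ge :
  (\sum_j \sum_b (prior b)%:E * \int[P]_w (\1_(error_set j (b j)) (noise w) *
      mixture (pattern b) (noise w))%:E <=
   'E_P[fun w => #|symdiff (Shat (obs w)) (support_mu mu w)|%:R])%E.
Proof.
have lossE w : #|symdiff (Shat (obs w)) (support_mu mu w)|%:R =
    \sum_j \1_(miss j) w :> R.
  rewrite -sum1_card natr_sum big_mkcond /=; apply: eq_bigr => j _.
  rewrite indicE /symdiff /support_mu !inE.
  have -> : (w \in miss j) = ((j \in Shat (obs w)) != (mu j w != 0)).
    by apply/idP/idP; rewrite !inE.
  by case: (j \in Shat _); case: (mu j w != 0).
have mmiss j : measurable_fun setT (fun w => (\1_(miss j) w)%:E : \bar R).
  exact/measurable_EFinP/measurable_indic.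
have mev b s j : measurable_fun setT (fun w => (\1_(event b s j) w)%:E : \bar R).
  exact/measurable_EFinP/measurable_indic.
rewrite expectation.unlock.
rewrite [leRHS](_ : _ = \int[P]_w (\sum_j (\1_(miss j) w)%:E))%E; last first.
  by apply: eq_integral => w _; rewrite lossE sumEFin.
rewrite ge0_integral_sum//; apply: lee_sum => j _.
rewrite (eq_bigr (fun b => \int[P]_w
    (\sum_(s : {ffun 'I_n -> bool}) (\1_(event b s j) w)%:E))%E); last first.
  move=> b _; rewrite ge0_integral_sum//.
  transitivity (\sum_(s : {ffun 'I_n -> bool}) (prior b)%:E * ((2^-1 ^+ n)%:E *
      \int[P]_w (\1_(error_set j (b j)) (noise w) *
        tilt (\matrix_(i, k) (sgnb R (s i) * pattern b k)) (noise w))%:E))%E;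
    last first.
    apply: eq_bigr => s _; rewrite integral_indic// setIT.
    by rewrite [RHS]PE EFinM muleA.
  rewrite -ge0_sume_distrr; last first.
    move=> s _; rewrite mule_ge0 ?lee_fin//; apply: integral_ge0 => w _.
    by rewrite lee_fin mulr_ge0 ?tilt_ge0.
  rewrite -ge0_sume_distrr; last first.
    by move=> s _; apply: integral_ge0 => w _; rewrite lee_fin mulr_ge0 ?tilt_ge0.
  congr (_ * _)%E.
  rewrite -ge0_integral_sum//.
  - rewrite -ge0_integralZl//.
    + apply: eq_integral => w _; rewrite sumEFin -EFinM -mulr_sumr mixtureE.
      by rewrite mulrCA.
    + under eq_fun do rewrite sumEFin -mulr_sumr.
      apply/measurable_EFinP/measurable_indic_noise.
      by apply: measurable_sum => s; exact: measurable_tilt_noise.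
    + move=> w _; rewrite sumEFin lee_fin; apply: sumr_ge0 => s _.
      by rewrite mulr_ge0 ?tilt_ge0.
  - move=> s; apply/measurable_EFinP/measurable_indic_noise.
    exact: measurable_tilt_noise.
  - by move=> s w _; rewrite lee_fin mulr_ge0 ?tilt_ge0.
rewrite -ge0_integral_sum//; last 2 first.
- by move=> b; apply: emeasurable_sum.
- by move=> b w _; apply: sume_ge0.
apply: ge0_le_integral => //.
- by move=> w _; apply: sume_ge0 => b _; apply: sume_ge0.
- by apply: emeasurable_sum => b; apply: emeasurable_sum.
move=> w _.
have [[b0 [s0 wbs]]|nobs] := pselect (exists b s, event b s j w); last first.
  rewrite big1 ?lee_fin// => b _; rewrite big1// => s _.
  by rewrite indicE memNset// => wbs; apply: nobs; exists b, s.
(* Disjointness: [b] can be read off [mu] because [t] is nonzero, and [s] off [ell]. *)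
have uniq b s : event b s j w -> b = b0 /\ s = s0.
  move=> [mb lb _]; case: wbs => mb0 lb0 _; split; apply/ffunP => k.
    have : pattern b k = pattern b0 k by rewrite -mb -mb0.
    rewrite /pattern; case: (b k); case: (b0 k) => // /eqP.
      by rewrite (negPf t_neq0).
    by rewrite eq_sym (negPf t_neq0).
  have : sgnb R (s k) = sgnb R (s0 k) by rewrite -lb -lb0.
  exact: signr_inj.
have -> : \1_(miss j) w = 1 :> R.
  rewrite indicE mem_set//; case: wbs => mb _; rewrite /error_set /miss /=.
  rewrite mb /pattern; case: (b0 j) => //=; first by rewrite t_neq0.
  by rewrite eqxx.
rewrite (bigD1 b0)//= [X in (_ + X)%E]big1 ?adde0; last first.
  move=> b bb0; rewrite big1// => s _; rewrite indicE memNset// => /uniq[bE _].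
  by rewrite bE eqxx in bb0.
rewrite (bigD1 s0)//= [X in (_ + X)%E]big1 ?adde0; last first.
  move=> s ss0; rewrite indicE memNset// => /uniq[_ sE].
  by rewrite sE eqxx in ss0.
by rewrite lee_fin indicE; case: (_ \in _).
Qed.

End risk.

(** * Testing between patterns that differ in one coordinate *)

Section risk_bound.
Variables (R : realType) (d : measure_display) (T : measurableType d).
Variables (P : probability T R) (n p : nat).
Variables (mu : 'I_p -> {RV P >-> R}) (ell : 'I_n -> {RV P >-> R}).
Variable Z : 'I_n -> 'I_p -> {RV P >-> R}.
Variables (alpha beta : R).
Hypothesis model : ARW_model mu ell Z alpha beta.
Variable Shat : 'M[R]_(n, p) -> {set 'I_p}.
Hypothesis mShat : measurable_estimate Shat.
Local Notation noise := (noise Z).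
Local Notation obs := (observation mu ell Z).
Local Notation t := (tau alpha p).
Local Notation e := (eps beta p).
Local Notation pattern := (pattern alpha).
Local Notation prior := (prior beta).
Local Notation error_set := (error_set Shat).
Hypothesis (t_neq0 : t != 0) (e_gt0 : 0 < e) (e_lt1 : e < 1).

Let r := e / (1 - e).
Let energy (b : {ffun 'I_p -> bool}) : R := \sum_j pattern b j ^+ 2.

(** Matches the two hypotheses on coordinate [j] that share all other entries. *)
Definition toggle (j : 'I_p) (b : {ffun 'I_p -> bool}) : {ffun 'I_p -> bool} :=
  [ffun k => b k (+) (k == j)].

Lemma toggleK j : involutive (toggle j).
Proof. by move=> b; apply/ffunP => k; rewrite !ffunE -addbA addbb addbF. Qed.

Lemma prior_toggle j (b : {ffun 'I_p -> bool}) :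
  ~~ b j -> prior (toggle j b) = r * prior b.
Proof.
move=> /negPf bj; rewrite /prior (bigD1 j)//= [in RHS](bigD1 j)//= ffunE bj eqxx /=.
rewrite /r mulrA divfK ?subr_eq0 ?gt_eqF//; congr (_ * _).
by apply: eq_bigr => k /negPf kj; rewrite ffunE kj addbF.
Qed.

Lemma prior_ge0 (b : {ffun 'I_p -> bool}) : 0 <= prior b.
Proof.
by apply: prodr_ge0 => j _; case: ifP; rewrite ?subr_ge0 ltW.
Qed.

(** The generating function at [g] of the binomial size of the support. *)
Lemma sum_prior (g : R) :
  \sum_(b : {ffun 'I_p -> bool}) prior b * \prod_j (if b j then g else 1) =
  (1 - e + e * g) ^+ p.
Proof.
under eq_bigr do rewrite /prior -big_split/=.
rewrite -(bigA_distr_bigA (fun (j : 'I_p) (c : bool) =>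
  (if c then e else 1 - e) * (if c then g else 1))) /=.
rewrite (eq_bigr (fun=> 1 - e + e * g)) ?prodr_const ?card_ord// => j _.
by rewrite big_bool /= mulr1 addrC.
Qed.

Lemma sum_prior0 j : \sum_(b : {ffun 'I_p -> bool} | ~~ b j) prior b = 1 - e.
Proof.
(* Weight 0 for [true] at [j] encodes the restriction on [b], so the sum still factorises. *)
transitivity (\sum_(b : {ffun 'I_p -> bool})
    \prod_k (if b k then (if k == j then 0 else e) else 1 - e)).
  rewrite big_mkcond/=; apply: eq_bigr => b _; case: ifPn => [bj|/negbNE bj].
    apply: eq_bigr => k _; case: ifP => // bk; case: eqP => // kj.
    by rewrite -kj bk in bj.
  by rewrite (bigD1 j)//= bj eqxx mul0r.
rewrite -(bigA_distr_bigA (fun (k : 'I_p) (c : bool) =>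
  if c then (if k == j then 0 else e) else 1 - e)) /=.
rewrite (bigD1 j)//= big_bool /= eqxx add0r big1 ?mulr1// => k /negPf ->.
by rewrite big_bool /= addrC subrK.
Qed.

(** The probability of an error at [j] given [mu = pattern b]; [QE] shows that [fine] is applied to
    a finite value. *)
Let Q j (b : {ffun 'I_p -> bool}) :=
  fine (\int[P]_w (\1_(error_set j (b j)) (noise w) *
  mixture (pattern b) (noise w))%:E).

Let mmixture u : measurable_fun setT (fun w => mixture u (noise w)).
Proof.
under eq_fun do rewrite mixtureE.
apply: measurable_funM => //; apply: measurable_sum => s.
exact: measurable_tilt_noise.
Qed.

Let QE j (b : {ffun 'I_p -> bool}) : (\int[P]_w (\1_(error_set j (b j)) (noise w) *
  mixture (pattern b) (noise w))%:E = (Q j b)%:E)%E.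
Proof.
rewrite /Q fineK// ge0_fin_numE; last first.
  by apply: integral_ge0 => w _; rewrite lee_fin mulr_ge0// ltW// mixture_gt0.
apply: le_lt_trans (ltry 1); rewrite -(integral_mixture_noise model (pattern b)).
apply: ge0_le_integral => //.
- by move=> w _; rewrite lee_fin mulr_ge0// ltW// mixture_gt0.
- exact/measurable_EFinP/measurable_indic_noise.
- exact/measurable_EFinP.
- move=> w _; rewrite lee_fin indicE; case: (_ \in _); rewrite ?mul1r ?mul0r//.
  by rewrite ltW// mixture_gt0.
Qed.

(* Integrates [r f' <= f + (r f')^2 / f] on the event [j \in Shat] and the trivial
   [r f' <= r f'] on its complement. *)
Lemma pair_risk j (b : {ffun 'I_p -> bool}) : ~~ b j ->
  r <= Q j b + r * Q j (toggle j b) + r ^+ 2 * chi2_row (energy b) (t ^+ 2) ^+ n.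
Proof.
move=> bj; set b' := toggle j b.
have b'j : b' j by rewrite ffunE eqxx addbT.
have uj : pattern b j = 0 by rewrite /pattern (negPf bj).
have vj : pattern b' j = t by rewrite /pattern b'j.
have uv k : k != j -> pattern b' k = pattern b k.
  by move=> /negPf kj; rewrite /pattern ffunE kj addbF.
have r0 : 0 <= r by rewrite divr_ge0// ?subr_ge0 ltW.
pose G w := \prod_i \sum_k chi2_weight (pattern b) t k *
  expR (\sum_l chi2_shift (pattern b) j t k l * noise w i l).
have sqG w : mixture (pattern b') (noise w) ^+ 2 <=
    mixture (pattern b) (noise w) * G w.
  exact: (mixture_sqr_le uj vj uv (noise w)).
have f0 w := mixture_gt0 (pattern b) (noise w).
have f'0 w := mixture_gt0 (pattern b') (noise w).
(* [G] has negative coefficients; its sign comes from the square that it dominates. *)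
have G0 w : 0 <= G w.
  by rewrite -(pmulr_rge0 _ (f0 w)) (le_trans _ (sqG w))// sqr_ge0.
have mG : measurable_fun setT G.
  apply: measurable_prod => i _; apply: measurable_sum => k.
  apply: measurable_funM => //; apply: measurableT_comp => //.
  apply: measurable_sum => l; apply: measurable_funM => //.
  by under eq_fun do rewrite mxE; exact: measurable_funP.
pose a1 w := \1_(error_set j (b j)) (noise w) * mixture (pattern b) (noise w).
pose a2 w := \1_(error_set j (b' j)) (noise w) * mixture (pattern b') (noise w).
have a10 w : 0 <= a1 w by rewrite mulr_ge0// ltW.
have a20 w : 0 <= a2 w by rewrite mulr_ge0// ltW.
have ma1 : measurable_fun setT a1 by exact: measurable_indic_noise.
have ma2 : measurable_fun setT a2 by exact: measurable_indic_noise.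
have pointwise w : r * mixture (pattern b') (noise w) <=
    a1 w + r * a2 w + r ^+ 2 * G w.
  have rG : 0 <= r ^+ 2 * G w by rewrite mulr_ge0// sqr_ge0.
  rewrite /a1 /a2 !indicE (negPf bj) b'j.
  have -> : (noise w \in error_set j false) = (j \in Shat (noise w)).
    by apply/idP/idP; rewrite inE /error_set /=; case: (_ \in _).
  have -> : (noise w \in error_set j true) = (j \notin Shat (noise w)).
    by apply/idP/idP; rewrite inE /error_set /=; case: (_ \in _).
  case: (j \in Shat _); rewrite /= ?(mul1r, mul0r, mulr0, addr0, add0r); last lra.
  (* Multiplied by [f], the claim reduces to [f^2 - r f f' + (r f')^2 >= 0], which is 3/4 of
     [(f - r f')^2] plus 1/4 of [(f + r f')^2]. *)
  rewrite -subr_ge0 -(pmulr_rge0 _ (f0 w)).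
  have := ler_wpM2l (sqr_ge0 r) (sqG w).
  move: (mixture _ _) (mixture _ _) (G w) => f f' g h.
  have := sqr_ge0 (f - r * f'); have := sqr_ge0 (f + r * f').
  nra.
have : (\int[P]_w (r * mixture (pattern b') (noise w))%:E <=
    \int[P]_w (a1 w + r * a2 w + r ^+ 2 * G w)%:E)%E.
  apply: ge0_le_integral => //.
  - by move=> w _; rewrite lee_fin mulr_ge0// ltW.
  - by apply/measurable_EFinP; exact: measurable_funM.
  - apply/measurable_EFinP; apply: measurable_funD; last exact: measurable_funM.
    by apply: measurable_funD => //; exact: measurable_funM.
  - by move=> w _; rewrite lee_fin.
have intZ (c : R) (f : T -> R) : 0 <= c -> measurable_fun setT f ->
    (forall w, 0 <= f w) ->
    (\int[P]_w (c * f w)%:E = c%:E * \int[P]_w (f w)%:E)%E.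
  move=> c0 mf pf; rewrite -ge0_integralZl//; first exact/measurable_EFinP.
  by move=> w _; rewrite lee_fin.
have intD (f g : T -> R) : measurable_fun setT f -> measurable_fun setT g ->
    (forall w, 0 <= f w) -> (forall w, 0 <= g w) ->
    (\int[P]_w (f w + g w)%:E = \int[P]_w (f w)%:E + \int[P]_w (g w)%:E)%E.
  move=> mf mg pf pg; rewrite -ge0_integralD//; try exact/measurable_EFinP.
  - by move=> w _; rewrite lee_fin.
  - by move=> w _; rewrite lee_fin.
have f'_ge0 w : 0 <= mixture (pattern b') (noise w) by rewrite ltW.
have := intZ r _ r0 (mmixture (pattern b')) f'_ge0.
rewrite (integral_mixture_noise model) mule1 => ->.
rewrite (intD (fun w => a1 w + r * a2 w) (fun w => r ^+ 2 * G w)); last 4 first.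
- by apply: measurable_funD => //; exact: measurable_funM.
- exact: measurable_funM.
- by move=> w; rewrite addr_ge0// mulr_ge0.
- by move=> w; rewrite mulr_ge0// sqr_ge0.
rewrite (intD a1 (fun w => r * a2 w))//; last 2 first.
- exact: measurable_funM.
- by move=> w; rewrite mulr_ge0.
rewrite (intZ r a2)// (intZ (r ^+ 2) G) ?sqr_ge0//.
rewrite (integral_chi2_noise model t uj) !QE -!EFinM -!EFinD lee_fin.
exact.
Qed.

(** As [exp (- q / 2) <= 1], the value is at least [cosh x]. The sign allows bounds to be raised to
    the power [n] and patterns to be added to the average. *)
Lemma chi2_row_ge0 (q x : R) : 0 <= q -> 0 <= x -> 0 <= chi2_row q x.
Proof.
move=> q0 x0; rewrite /chi2_row.
have E1 : expR (- q / 2) <= 1 by rewrite -[leRHS]expR0 ler_expR; lra.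
have E2 : expR (- x) <= expR x by rewrite ler_expR; lra.
have := expR_gt0 (- x); have := expR_gt0 x.
have : expR (- q / 2) * (expR x - expR (- x)) <= expR x - expR (- x).
  by rewrite ler_piMl// subr_ge0.
lra.
Qed.

(** Each pattern without [j] is grouped with its toggled partner, of prior [r] times larger;
    [pair_risk] is then summed, the leading terms giving [r * (1 - e) = e]. *)
Lemma loss_coordinate_ge j K :
  \sum_b prior b * chi2_row (energy b) (t ^+ 2) ^+ n <= K ->
  e - r ^+ 2 * K <= \sum_b prior b * Q j b.
Proof.
move=> KP.
have r0 : 0 <= r by rewrite divr_ge0// ?subr_ge0 ltW.
have en0 b : 0 <= energy b by apply: sumr_ge0 => k _; exact: sqr_ge0.
have chi0 b : 0 <= prior b * chi2_row (energy b) (t ^+ 2) ^+ n.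
  by rewrite mulr_ge0 ?prior_ge0// exprn_ge0// chi2_row_ge0// sqr_ge0.
rewrite (bigID (fun b : {ffun 'I_p -> bool} => ~~ b j))/=.
rewrite [X in _ <= _ + X](reindex_inj (inv_inj (toggleK j)))/=.
rewrite [X in _ <= _ + X](eq_bigl (fun b : {ffun 'I_p -> bool} => ~~ b j)); last first.
  by move=> b; rewrite ffunE eqxx addbT negbK.
rewrite -big_split/=.
apply: le_trans (_ : \sum_(b : {ffun 'I_p -> bool} | ~~ b j)
   (r * prior b - r ^+ 2 * (prior b * chi2_row (energy b) (t ^+ 2) ^+ n)) <= _).
  rewrite sumrB -mulr_sumr sum_prior0 -mulr_sumr.
  rewrite {2}/r divfK ?subr_eq0 ?gt_eqF// lerD2l lerN2 ler_wpM2l ?sqr_ge0//.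
  (* Nonnegative terms with [b j] are added, so that the bound no longer depends on [j]. *)
  apply: le_trans KP; rewrite [leLHS]big_mkcond/=; apply: ler_sum => b _.
  by case: ifP => // _; exact: chi0.
apply: ler_sum => b bj; rewrite prior_toggle//.
have := ler_wpM2l (prior_ge0 b) (pair_risk bj).
lra.
Qed.

Lemma Hamm_ge K : (0 < p)%N ->
  \sum_b prior b * chi2_row (energy b) (t ^+ 2) ^+ n <= K ->
  ((1 - e / (1 - e) ^+ 2 * K)%:E <= Hamm mu ell Z beta Shat)%E.
Proof.
move=> p0 KP; rewrite /Hamm.
have pe0 : 0 < p%:R * e by rewrite mulr_gt0// ltr0n.
apply: (@le_trans _ _ (((p%:R * e)^-1)%:E *
    (\sum_(j < p) \sum_b prior b * Q j b)%:E))%E; last first.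
  rewrite lee_pmul2l ?lte_fin ?invr_gt0//.
  apply: le_trans (expected_loss_ge model mShat t_neq0).
  rewrite -sumEFin; apply: lee_sum => j _; rewrite -sumEFin; apply: lee_sum => b _.
  by rewrite QE EFinM.
rewrite -EFinM lee_fin ler_pdivlMl//.
apply: (@le_trans _ _ (\sum_(j < p) (e - r ^+ 2 * K))); last first.
  by apply: ler_sum => j _; exact: loss_coordinate_ge.
rewrite sumr_const card_ord -mulr_natl le_eqVlt; apply/orP; left.
apply/eqP; rewrite /r; field.
by rewrite subr_eq0 gt_eqF.
Qed.

End risk_bound.

(** * Asymptotics *)

Lemma limn_einf_ge (R : realType) (u : (\bar R)^nat) (l : R) :
  (forall delta, 0 < delta -> exists N, forall p, (N <= p)%N ->
    ((l - delta)%:E <= u p)%E) ->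
  (l%:E <= limn_einf u)%E.
Proof.
move=> H; rewrite limn_einf_lim; apply/lee_addgt0Pr => delta delta0.
rewrite -leeBlDr// -EFinB; have [N NP] := H _ delta0.
apply: lime_ge; first exact: is_cvg_einfs.
exists N => //= k Nk; apply: le_ereal_inf_tmp => _ [m /= km <-].
exact/NP/(leq_trans Nk).
Qed.

Lemma powR_natN_le (R : realType) (c delta : R) : 0 < c -> 0 < delta ->
  exists N, forall p, (N <= p)%N -> p%:R `^ (- c) <= delta.
Proof.
move=> c0 d0; pose B := delta^-1 `^ c^-1.
have B0 : 0 < B by rewrite powR_gt0 ?invr_gt0.
exists (Num.bound B) => p Np.
have Bp : B <= p%:R.
  by rewrite (le_trans (ltW (archi_boundP (ltW B0))))// ler_nat.
have : B `^ c <= p%:R `^ c by rewrite ge0_ler_powR ?nnegrE// ltW.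
have d'0 : 0 <= delta^-1 by rewrite invr_ge0 ltW.
rewrite -powRrM mulVf ?gt_eqF// powRr1// => H.
have pc0 : 0 < p%:R `^ c by apply: lt_le_trans H; rewrite invr_gt0.
by rewrite powRN invf_ple.
Qed.

(** * Elementary bounds on the second moment of one row *)

Section chi2_bounds.
Variable R : realType.
Implicit Types x q : R.

(** All four follow from [1 + y <= exp y] at [y = x] and [y = - x], with [exp x * exp (- x) = 1]. *)
Let expR_bounds x : 0 <= x <= 1 / 2 ->
  [/\ expR x <= 1 + 2 * x, expR x <= 1 + x + 2 * x ^+ 2,
      1 - x <= expR (- x) & expR (- x) <= 1 - x + x ^+ 2].
Proof.
move=> /andP[x0 x1].
have Ep := expR_ge1Dx x; have En := expR_ge1Dx (- x).
have E0 := expR_gt0 x; have E'0 := expR_gt0 (- x).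
have EE : expR x * expR (- x) = 1 by rewrite -expRD subrr expR0.
move: (expR x) (expR (- x)) Ep En E0 E'0 EE => a b Ep En E0 E'0 EE.
have a1 : a * (1 - x) <= 1 by rewrite -[leRHS]EE ler_pM2l.
have b1 : b * (1 + x) <= 1 by rewrite -[leRHS]EE mulrC ler_pM2r.
split; last 2 first.
- lra.
- rewrite -(@ler_pM2r _ (1 + x)); last lra.
  apply: le_trans b1 _; have : 0 <= x ^+ 3 by exact: exprn_ge0.
  lra.
- rewrite -(@ler_pM2r _ (1 - x)); last lra.
  apply: le_trans a1 _; have : 0 <= x * (1 - 2 * x) by apply: mulr_ge0; lra.
  lra.
- rewrite -(@ler_pM2r _ (1 - x)); last lra.
  apply: le_trans a1 _.
  have : 0 <= x ^+ 2 * (1 - 2 * x) by apply: mulr_ge0; [exact: sqr_ge0|lra].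
  lra.
Qed.

(** Uses [1 - exp (- q / 2) <= 1]: a bound linear in [x], uniform in [q]. *)
Lemma chi2_row_le x q : 0 <= x <= 1 / 2 -> chi2_row q x <= expR (4 * x).
Proof.
move=> xh; have [E1 _ E2 _] := expR_bounds xh; have /andP[x0 _] := xh.
apply: le_trans (expR_ge1Dx _); rewrite /chi2_row.
have EE : expR (- x) <= expR x by rewrite ler_expR; lra.
have : 0 <= expR (- q / 2) * (expR x - expR (- x)).
  by rewrite mulr_ge0 ?expR_ge0// subr_ge0.
lra.
Qed.

(** Uses [1 - exp (- q / 2) <= q / 2], which leaves [cosh x + q sinh x]: the term linear in [x] now
    carries the factor [q]. *)
Lemma chi2_row_le_sparse x q : 0 <= x <= 1 / 2 -> 0 <= q ->
  chi2_row q x <= expR (2 * x ^+ 2 + 2 * q * x).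
Proof.
move=> xh q0; have [E1 E2 E3 E4] := expR_bounds xh; have /andP[x0 _] := xh.
apply: le_trans (expR_ge1Dx _); rewrite /chi2_row.
have EE : expR (- x) <= expR x by rewrite ler_expR; lra.
have Q1 : 1 - q / 2 <= expR (- q / 2).
  by apply: le_trans (expR_ge1Dx _); rewrite mulNr.
have : (1 - q / 2) * (expR x - expR (- x)) <=
    expR (- q / 2) * (expR x - expR (- x)) by rewrite ler_wpM2r// subr_ge0.
have : q * (expR x - expR (- x)) <= q * (3 * x) by rewrite ler_wpM2l//; lra.
have : 0 <= q * x by rewrite mulr_ge0.
have : 0 <= x ^+ 2 by exact: sqr_ge0.
lra.
Qed.

End chi2_bounds.

(** * Averaging the second moment over the prior *)

Section average_chi2.
Variables (R : realType) (alpha beta : R) (n p : nat).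
Local Notation t := (tau alpha p).
Local Notation e := (eps beta p).
Hypotheses (e_gt0 : 0 < e) (e_lt1 : e < 1) (t_le : t ^+ 2 <= 1 / 2).

Let energy (b : {ffun 'I_p -> bool}) : R := \sum_j pattern alpha b j ^+ 2.

Let th : 0 <= t ^+ 2 <= 1 / 2.
Proof. by rewrite sqr_ge0. Qed.

Let energy_ge0 b : 0 <= energy b.
Proof. by apply: sumr_ge0 => j _; exact: sqr_ge0. Qed.

Lemma average_chi2_le (C : R) : n%:R * t ^+ 2 <= C ->
  \sum_b prior beta b * chi2_row (energy b) (t ^+ 2) ^+ n <= expR (4 * C).
Proof.
(* The product of ones puts the total prior mass in the form of [sum_prior] at [g = 1]. *)
move=> nC; apply: (@le_trans _ _ (\sum_(b : {ffun 'I_p -> bool}) prior beta b *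
    \prod_j (if b j then 1 else 1) * expR (4 * C))).
  apply: ler_sum => b _; rewrite big1 ?mulr1; last by move=> j _; case: ifP.
  rewrite ler_wpM2l ?prior_ge0//.
  apply: (@le_trans _ _ (expR (4 * t ^+ 2) ^+ n)).
    apply: lerXn2r; rewrite ?nnegrE ?expR_ge0 ?chi2_row_ge0 ?sqr_ge0//.
    exact: chi2_row_le.
  by rewrite -expRM_natl ler_expR; lra.
by rewrite -mulr_suml sum_prior mulr1 subrK expr1n mul1r.
Qed.

(** The energy is [t^2] times the support size [k], so the [n]-th power of the row bound is
    [g * g^k] with [g = exp (2 n t^4)]. Its average is [g * (1 + e (g - 1))^p <= g * exp (p e (g -
    1))]. *)
Lemma average_chi2_le_sparse (C : R) :
  n%:R * t ^+ 4 <= C -> n%:R * t ^+ 4 * (p%:R * e) <= C ->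
  \sum_b prior beta b * chi2_row (energy b) (t ^+ 2) ^+ n <=
  expR (2 * C + 2 * C * expR (2 * C)).
Proof.
move=> nC npC; pose lambda := 2 * n%:R * t ^+ 4; pose g := expR lambda.
have t4 : t ^+ 4 = t ^+ 2 * t ^+ 2 by rewrite -exprD.
have t40 : 0 <= t ^+ 4 by rewrite t4 mulr_ge0 ?sqr_ge0.
have lambda0 : 0 <= lambda by rewrite mulr_ge0// mulr_ge0.
have energyE b : expR (2 * n%:R * energy b * t ^+ 2) =
    \prod_j (if b j then g else 1).
  rewrite /energy mulr_sumr mulr_suml expR_sum; apply: eq_bigr => j _.
  rewrite /pattern; case: (b j); last by rewrite expr0n mulr0 mul0r expR0.
  by congr expR; rewrite /lambda t4 mulrA.
apply: (@le_trans _ _ (\sum_(b : {ffun 'I_p -> bool}) prior beta b *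
    \prod_j (if b j then g else 1) * g)).
  apply: ler_sum => b _; rewrite -mulrA ler_wpM2l ?prior_ge0//.
  apply: (@le_trans _ _
      (expR (2 * (t ^+ 2) ^+ 2 + 2 * energy b * t ^+ 2) ^+ n)).
    apply: lerXn2r; rewrite ?nnegrE ?expR_ge0 ?chi2_row_ge0 ?sqr_ge0//.
    exact: chi2_row_le_sparse.
  rewrite -expRM_natl -energyE -expRD ler_expR /lambda t4.
  by rewrite le_eqVlt; apply/orP; left; apply/eqP; ring.
rewrite -mulr_suml sum_prior expRD mulrC.
apply: ler_pM; rewrite ?expR_ge0//.
- rewrite exprn_ge0// addr_ge0 ?subr_ge0 ?(ltW e_lt1)// mulr_ge0 ?expR_ge0//.
  exact: ltW.
- by rewrite ler_expR /lambda; lra.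
apply: (@le_trans _ _ (expR (e * (g - 1)) ^+ p)).
  apply: lerXn2r; rewrite ?nnegrE ?expR_ge0//.
    rewrite addr_ge0 ?subr_ge0 ?(ltW e_lt1)// mulr_ge0 ?expR_ge0//.
    exact: ltW.
  by apply: le_trans (expR_ge1Dx _); lra.
rewrite -expRM_natl ler_expR.
(* [g - 1 <= lambda g], from [1 - lambda <= exp (- lambda)] *)
have g1 : g - 1 <= lambda * g.
  have : g * (1 - lambda) <= 1.
    have gg : g * expR (- lambda) = 1 by rewrite -expRD subrr expR0.
    by rewrite -[leRHS]gg ler_wpM2l ?expR_ge0// expR_ge1Dx.
  lra.
have gC : g <= expR (2 * C) by rewrite ler_expR /lambda; lra.
apply: (@le_trans _ _ (p%:R * (e * (lambda * g)))).
  by rewrite !ler_wpM2l// ltW.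
rewrite (_ : _ * _ = (2 * (n%:R * t ^+ 4 * (p%:R * e))) * g); last first.
  by rewrite /lambda; ring.
apply: ler_pM; rewrite ?expR_ge0//; last lra.
by rewrite mulr_ge0// mulr_ge0// mulr_ge0// ltW.
Qed.

End average_chi2.

(** * Exponents of [p] in the two regimes of the curve *)

Section asymptotics.
Variables (R : realType) (alpha beta theta : R).

Let powR_natD (p : nat) (x y : R) : (0 < p)%N ->
  p%:R `^ x * p%:R `^ y = p%:R `^ (x + y).
Proof. by move=> p0; rewrite powRD// pnatr_eq0 -lt0n p0 implybT. Qed.

Let powR_nat_le1 (p : nat) (x : R) : (0 < p)%N -> x <= 0 -> p%:R `^ x <= 1.
Proof.
by move=> p0 x0; rewrite -[leRHS](powRr0 p%:R) ler_powR// ler1n.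
Qed.

Let tau_exp p k : tau alpha p ^+ k = p%:R `^ (- (alpha * k%:R)).
Proof. by rewrite -powR_mulrn ?powR_ge0// -powRrM mulNr. Qed.

(** The factor 2 absorbs the rounding error, which is below [1 <= p ^ theta]. *)
Lemma sample_size_le (n : nat -> nat) p : sample_size theta n -> 0 <= theta ->
  (0 < p)%N -> (n p)%:R <= 2 * p%:R `^ theta.
Proof.
move=> /(_ p) hn th0 p0; have : 1 <= p%:R `^ theta.
  by rewrite -[leLHS](powRr0 p%:R) ler_powR// ?ler1n// ltW.
by move: hn; rewrite ltr_norml => /andP[_]; lra.
Qed.

(** Above the curve the exponents are negative: [theta - 2 alpha] in the first regime,
    [theta - 4 alpha] and [theta - 4 alpha + 1 - beta] in the second. The powers of [p] are then at
    most 1, and [C = 2] is the factor of [sample_size_le]. *)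
Lemma average_chi2_bounded (n : nat -> nat) :
  0 < alpha -> 0 < theta -> beta < 1 ->
  eta_sig theta beta < alpha -> sample_size theta n ->
  exists2 K : R, 0 < K & forall p, (0 < p)%N ->
    0 < eps beta p < 1 -> tau alpha p ^+ 2 <= 1 / 2 ->
    \sum_(b : {ffun 'I_p -> bool}) prior beta b *
      chi2_row (\sum_j pattern alpha b j ^+ 2) (tau alpha p ^+ 2) ^+ n p <= K.
Proof.
move=> a0 th0 b1; rewrite /eta_sig; case: ifPn => [_ ha hn|].
  exists (expR (4 * 2)) => [|p p0 /andP[e0 e1] t2]; first exact: expR_gt0.
  apply: average_chi2_le => //.
  apply: (@le_trans _ _ (2 * p%:R `^ theta * tau alpha p ^+ 2)).
    by rewrite ler_wpM2r ?sqr_ge0// sample_size_le// ltW.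
  rewrite tau_exp -mulrA powR_natD//.
  have : p%:R `^ (theta - alpha * 2) <= 1 by apply: powR_nat_le1 => //; lra.
  lra.
rewrite -ltNge => hb ha hn.
exists (expR (2 * 2 + 2 * 2 * expR (2 * 2))) => [|p p0 /andP[e0 e1] t2].
  exact: expR_gt0.
have t4 : (n p)%:R * tau alpha p ^+ 4 <= 2 * p%:R `^ (theta - alpha * 4).
  rewrite -powR_natD// mulrA -tau_exp ler_wpM2r//.
    by rewrite tau_exp powR_ge0.
  by rewrite sample_size_le// ltW.
apply: average_chi2_le_sparse => //.
  apply: (le_trans t4).
  have : p%:R `^ (theta - alpha * 4) <= 1 by apply: powR_nat_le1 => //; lra.
  lra.
have pe : p%:R * eps beta p = p%:R `^ (1 - beta).
  by rewrite /eps -{1}(powRr1 (ler0n R p)) powR_natD.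
apply: (@le_trans _ _ (2 * p%:R `^ (theta - alpha * 4) * p%:R `^ (1 - beta))).
  by rewrite pe ler_wpM2r ?powR_ge0.
rewrite -mulrA powR_natD//.
have : p%:R `^ (theta - alpha * 4 + (1 - beta)) <= 1.
  by apply: powR_nat_le1 => //; lra.
lra.
Qed.

End asymptotics.

Theorem theorem3p1 (R : realType) (alpha beta theta : R)
  (halpha : 0 < alpha < 1) (hbeta : 0 < beta < 1) (htheta : 0 < theta < 1)
  (hcurve : eta_sig theta beta < alpha)
  (n : nat -> nat) (hn : sample_size theta n)
  (d : nat -> measure_display) (T : forall p : nat, measurableType (d p))
  (P : forall p : nat, probability (T p) R)
  (mu : forall p : nat, 'I_p -> {RV (P p) >-> R})
  (ell : forall p : nat, 'I_(n p) -> {RV (P p) >-> R})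
  (Z : forall p : nat, 'I_(n p) -> 'I_p -> {RV (P p) >-> R})
  (hmodel : forall p : nat, ARW_model (mu p) (ell p) (Z p) alpha beta)
  (Shat : forall p : nat, 'M[R]_(n p, p) -> {set 'I_p})
  (hShat : forall p : nat, measurable_estimate (Shat p)) :
  (1 <= limn_einf (fun p : nat => Hamm (mu p) (ell p) (Z p) beta (Shat p)))%E.
Proof.
have [/andP[a0 _] /andP[b0 b1] /andP[th0 _]] := And3 halpha hbeta htheta.
have [K K0 KP] := average_chi2_bounded a0 th0 b1 hcurve hn.
apply: limn_einf_ge => delta delta0.
have half0 : 0 < 1 / 2 :> R by lra.
(* [eps <= 1 / 2] gives [(1 - eps)^2 >= 1 / 4], and [eps <= delta / (4 K)] then makes
   [eps / (1 - eps)^2 * K] at most [delta]. *)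
have eta0 : 0 < Num.min (1 / 2) (delta / (4 * K)).
  by rewrite lt_min half0 divr_gt0// mulr_gt0.
have [N1 N1P] := powR_natN_le b0 eta0.
have a20 : 0 < alpha * 2 by lra.
have [N2 N2P] := powR_natN_le a20 half0.
(* The 1 excludes [p = 0], where negative powers take the default value 0. *)
exists (maxn 1 (maxn N1 N2)) => p; rewrite !geq_max => /and3P[p0 pN1 pN2].
have /andP[e12 ed] : (eps beta p <= 1 / 2) && (eps beta p <= delta / (4 * K)).
  by rewrite -le_min; exact: N1P.
have e0 : 0 < eps beta p by rewrite powR_gt0// ltr0n.
have e1 : eps beta p < 1 by lra.
have t2 : tau alpha p ^+ 2 <= 1 / 2.
  by rewrite /tau -powR_mulrn ?powR_ge0// -powRrM mulNr N2P.
have tn0 : tau alpha p != 0 by rewrite gt_eqF// powR_gt0// ltr0n.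
have e01 : 0 < eps beta p < 1 by rewrite e0.
apply: le_trans
  (Hamm_ge (hmodel p) (hShat p) tn0 e0 e1 p0 (KP p p0 e01 t2)).
rewrite lee_fin lerD2l lerN2.
have sq0 : 0 < (1 - eps beta p) ^+ 2 by rewrite exprn_gt0// subr_gt0.
rewrite mulrAC ler_pdivrMr//.
move: ed; rewrite ler_pdivlMr ?mulr_gt0// => ed.
apply: (@le_trans _ _ (delta * (1 / 4))); first lra.
rewrite ler_wpM2l ?(ltW delta0)//.
have := sqr_ge0 (1 / 2 - eps beta p).
nra.
Qed.
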